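(* Let $\bar x\in\mathbb{R}^n$ be a feasible point of the disjunctive problem $\min_x f(x)$ s.t. $F(x)\in\Gamma$. Then the following assertions hold. (a) If $\bar x$ is AM-stationary and AM-regular, then it is M-stationary. (b) If $\bar x$ is SAS-stationary and AS-regular, then it is S-stationary.
   Context: Here $f\colon\mathbb{R}^n\to\mathbb{R}$ and $F\colon\mathbb{R}^n\to\mathbb{R}^\ell$ are continuously differentiable, $\Gamma=\bigcup_{j=1}^t\Gamma_j$ with convex polyhedral sets $\Gamma_1,\dots,\Gamma_t\subset\mathbb{R}^\ell$, and $F'(x)$ is the Jacobian of $F$ at $x$. For a closed set $\Omega$ and $y\in\Omega$, the regular normal cone is $\widehat N_\Omega(y)=\{\xi\mid \forall z\in\Omega\colon \xi^\top(z-y)\le o(\|z-y\|)\}$; the limiting normal cone $N_\Omega(y)$ is the set of all limits of sequences $\xi^k\in\widehat N_\Omega(y^k)$ with $y^k\to y$, $y^k\in\Omega$. Both cones are set to $\emptyset$ for $y\notin\Omega$. For a set-valued map $\Upsilon$, $\limsup_{z\to\bar z}\Upsilon(z)$ is the set of all $y$ for which there exist $z^k\to\bar z$ and $y^k\to y$ with $y^k\in\Upsilon(z^k)$ for all $k$. A feasible point $\bar x$ is called: - M-stationary (S-stationary) if there is $\lambda\in\mathbb{R}^\ell$ with $0=\nabla f(\bar x)+F'(\bar x)^\top\lambda$ and $\lambda\in N_\Gamma(F(\bar x))$ (respectively $\lambda\in\widehat N_\Gamma(F(\bar x))$); - AM-stationary if there is a sequence $\{(x^k,\lambda^k,\delta^k,\varepsilon^k)\}_{k=1}^\infty\subset\mathbb{R}^n\times\mathbb{R}^\ell\times\mathbb{R}^\ell\times\mathbb{R}^n$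 with $(x^k,\delta^k,\varepsilon^k)\to(\bar x,0,0)$ and, for all $k$, $\varepsilon^k=\nabla f(x^k)+F'(x^k)^\top\lambda^k$ and $\lambda^k\in N_\Gamma(F(x^k)-\delta^k)$; - SAS-stationary if there is a sequence $\{(x^k,\lambda^k,\varepsilon^k)\}_{k=1}^\infty\subset\mathbb{R}^n\times\mathbb{R}^\ell\times\mathbb{R}^n$ with $(x^k,\varepsilon^k)\to(\bar x,0)$ and, for all $k$, $\varepsilon^k=\nabla f(x^k)+F'(x^k)^\top\lambda^k$ and $\lambda^k\in\widehat N_\Gamma(F(\bar x))$; - AM-regular if $\limsup_{x\to\bar x,\,\delta\to0}F'(x)^\top N_\Gamma(F(x)-\delta)\subset F'(\bar x)^\top N_\Gamma(F(\bar x))$; - AS-regular if $\limsup_{x\to\bar x}F'(x)^\top\widehat N_\Gamma(F(\bar x))\subset F'(\bar x)^\top\widehat N_\Gamma(F(\bar x))$. *)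

(* Defs.v *)
From HB Require Import structures.
From mathcomp Require Import all_boot all_order all_algebra.
From mathcomp Require Import all_classical all_reals all_analysis.

Set Implicit Arguments.
Unset Strict Implicit.
Unset Printing Implicit Defensive.

Import Order.TTheory GRing.Theory Num.Theory.
Import numFieldNormedType.Exports.

Local Open Scope classical_set_scope.
Local Open Scope ring_scope.

(* Vectors of R^n are row vectors 'rV[R]_n, with the topology and the (maximum)
   norm of the library.  Hence the product M^T v of the column convention is
   written v *m M below. *)

Definition dotv (R : realType) (n : nat) (u v : 'rV[R]_n) : R :=
  \sum_(i < n) u 0 i * v 0 i.

(* The library's 'J F x has partial derivatives of F_i in its i-th column; the
   transpose gives the usual Jacobian (dF_i/dx_j)_(i, j). *)
Definition jacobian_mx (R : realType) (n l : nat) (F : 'rV[R]_n -> 'rV[R]_l)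
    (x : 'rV[R]_n) : 'M[R]_(l, n) :=
  ('J F x)^T.

Definition gradient (R : realType) (n : nat) (f : 'rV[R]_n -> R)
    (x : 'rV[R]_n) : 'rV[R]_n :=
  \row_(j < n) 'd f x (delta_mx 0 j).

Definition cont_diff_fun (R : realType) (n : nat) (f : 'rV[R]_n -> R) : Prop :=
  (forall x, differentiable f x) /\ continuous (gradient f).

Definition cont_diff_map (R : realType) (n l : nat)
    (F : 'rV[R]_n -> 'rV[R]_l) : Prop :=
  (forall x, differentiable F x) /\ continuous (jacobian_mx F).

Definition convex_polyhedral (R : realType) (l : nat) (P : set 'rV[R]_l) :
    Prop :=
  exists (m : nat) (a : 'I_m -> 'rV[R]_l) (b : 'I_m -> R),
    P = [set y | forall i, dotv (a i) y <= b i].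

(* The condition <xi, z - y> <= o(|z - y|) for z in Omega, with the little-o
   unfolded; it does not depend on the norm, all norms being equivalent. *)
Definition regular_normal_cone (R : realType) (l : nat) (Omega : set 'rV[R]_l)
    (y : 'rV[R]_l) : set 'rV[R]_l :=
  [set xi | Omega y /\
    forall e : R, 0 < e ->
      \forall z \near y, Omega z -> dotv xi (z - y) <= e * `|z - y|].

Definition limiting_normal_cone (R : realType) (l : nat) (Omega : set 'rV[R]_l)
    (y : 'rV[R]_l) : set 'rV[R]_l :=
  [set xi | Omega y /\
    exists (ys xis : nat -> 'rV[R]_l),
      [/\ forall k, Omega (ys k),
          ys @ \oo --> y,
          xis @ \oo --> xi
        & forall k, regular_normal_cone Omega (ys k) (xis k)]].

Definition outer_limit (Z Y : topologicalType) (U : Z -> set Y) (zbar : Z) :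
    set Y :=
  [set y | exists (zs : nat -> Z) (ys : nat -> Y),
      [/\ zs @ \oo --> zbar,
          ys @ \oo --> y
        & forall k, U (zs k) (ys k)]].

Definition feasible (R : realType) (n l : nat) (F : 'rV[R]_n -> 'rV[R]_l)
    (Gamma : set 'rV[R]_l) (x : 'rV[R]_n) : Prop :=
  Gamma (F x).

Definition M_stationary (R : realType) (n l : nat) (f : 'rV[R]_n -> R)
    (F : 'rV[R]_n -> 'rV[R]_l) (Gamma : set 'rV[R]_l) (xbar : 'rV[R]_n) :
    Prop :=
  exists lam : 'rV[R]_l,
    0 = gradient f xbar + lam *m jacobian_mx F xbar /\
    limiting_normal_cone Gamma (F xbar) lam.

Definition S_stationary (R : realType) (n l : nat) (f : 'rV[R]_n -> R)
    (F : 'rV[R]_n -> 'rV[R]_l) (Gamma : set 'rV[R]_l) (xbar : 'rV[R]_n) :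
    Prop :=
  exists lam : 'rV[R]_l,
    0 = gradient f xbar + lam *m jacobian_mx F xbar /\
    regular_normal_cone Gamma (F xbar) lam.

Definition AM_stationary (R : realType) (n l : nat) (f : 'rV[R]_n -> R)
    (F : 'rV[R]_n -> 'rV[R]_l) (Gamma : set 'rV[R]_l) (xbar : 'rV[R]_n) :
    Prop :=
  exists (xs : nat -> 'rV[R]_n) (lams deltas : nat -> 'rV[R]_l)
         (epss : nat -> 'rV[R]_n),
    [/\ xs @ \oo --> xbar,
        deltas @ \oo --> (0 : 'rV[R]_l),
        epss @ \oo --> (0 : 'rV[R]_n),
        forall k, epss k = gradient f (xs k) + lams k *m jacobian_mx F (xs k)
      & forall k, limiting_normal_cone Gamma (F (xs k) - deltas k) (lams k)].

(* In contrast to AM-stationarity, the normal cone is taken at F xbar. *)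
Definition SAS_stationary (R : realType) (n l : nat) (f : 'rV[R]_n -> R)
    (F : 'rV[R]_n -> 'rV[R]_l) (Gamma : set 'rV[R]_l) (xbar : 'rV[R]_n) :
    Prop :=
  exists (xs : nat -> 'rV[R]_n) (lams : nat -> 'rV[R]_l)
         (epss : nat -> 'rV[R]_n),
    [/\ xs @ \oo --> xbar,
        epss @ \oo --> (0 : 'rV[R]_n),
        forall k, epss k = gradient f (xs k) + lams k *m jacobian_mx F (xs k)
      & forall k, regular_normal_cone Gamma (F xbar) (lams k)].

Definition AM_regular (R : realType) (n l : nat) (F : 'rV[R]_n -> 'rV[R]_l)
    (Gamma : set 'rV[R]_l) (xbar : 'rV[R]_n) : Prop :=
  outer_limit
    (fun p : 'rV[R]_n * 'rV[R]_l =>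
       [set lam *m jacobian_mx F p.1 |
         lam in limiting_normal_cone Gamma (F p.1 - p.2)])
    (xbar, 0)
  `<=` [set lam *m jacobian_mx F xbar |
         lam in limiting_normal_cone Gamma (F xbar)].

Definition AS_regular (R : realType) (n l : nat) (F : 'rV[R]_n -> 'rV[R]_l)
    (Gamma : set 'rV[R]_l) (xbar : 'rV[R]_n) : Prop :=
  outer_limit
    (fun x : 'rV[R]_n =>
       [set lam *m jacobian_mx F x |
         lam in regular_normal_cone Gamma (F xbar)])
    xbar
  `<=` [set lam *m jacobian_mx F xbar |
         lam in regular_normal_cone Gamma (F xbar)].

(* Main.v *)
Require Import Defs.
From HB Require Import structures.
From mathcomp Require Import all_boot all_order all_algebra.
From mathcomp Require Import all_classical all_reals all_analysis.

Import Order.TTheory GRing.Theory Num.Theory.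
Import numFieldNormedType.Exports.

Local Open Scope classical_set_scope.
Local Open Scope ring_scope.

(** The approximate stationarity equation eps_k = grad f(x_k) + F'(x_k)^T lam_k
    says nothing about the multipliers lam_k themselves, which may be unbounded,
    but it does control the products F'(x_k)^T lam_k: since eps_k tends to 0 and
    grad f is continuous, they tend to - grad f(xbar).  So - grad f(xbar) lies
    in the outer limit of the sets F'(x)^T N, with N the normal cone at hand, and
    regularity puts it in F'(xbar)^T N: a vector lam of N at xbar then satisfies
    grad f(xbar) + F'(xbar)^T lam = 0.  The argument is the same for both kinds
    of stationarity, which differ only in the cone N. *)

Lemma cvg_residual_sub_gradient (R : realType) (n : nat) (f : 'rV[R]_n -> R)
    (xbar : 'rV[R]_n) (xs epss vs : nat -> 'rV[R]_n) :
  continuous (gradient f) -> xs @ \oo --> xbar ->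
  epss @ \oo --> (0 : 'rV[R]_n) ->
  (forall k, epss k = gradient f (xs k) + vs k) ->
  vs @ \oo --> - gradient f xbar.
Proof.
move=> cf xs_xbar epss0 epssE.
have grad_cvg : gradient f \o xs @ \oo --> gradient f xbar.
  exact: (cvg_comp _ _ xs_xbar (cf xbar)).
have -> : vs = epss - (gradient f \o xs).
  by apply/funext => k; rewrite !fctE epssE addrC addKr.
by have := cvgB epss0 grad_cvg; rewrite sub0r; apply.
Qed.

Theorem proposition3p14 (R : realType) (n l t : nat)
    (f : 'rV[R]_n -> R) (F : 'rV[R]_n -> 'rV[R]_l)
    (Gammas : 'I_t -> set 'rV[R]_l) (Gamma : set 'rV[R]_l)
    (xbar : 'rV[R]_n)
    (hf : cont_diff_fun f) (hF : cont_diff_map F)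
    (hGammas : forall j : 'I_t, convex_polyhedral (Gammas j))
    (hGamma : Gamma = \bigcup_(j in [set: 'I_t]) Gammas j)
    (hxbar : feasible F Gamma xbar) :
  (AM_stationary f F Gamma xbar -> AM_regular F Gamma xbar ->
     M_stationary f F Gamma xbar) /\
  (SAS_stationary f F Gamma xbar -> AS_regular F Gamma xbar ->
     S_stationary f F Gamma xbar).
Proof.
case: hf => _ cf; split.
- move=> [xs [lams [deltas [epss [xs_xbar deltas0 epss0 epssE lamsN]]]]] reg.
  have [|lam lamN lamE] := reg (- gradient f xbar); last first.
    by exists lam; split=> //; rewrite lamE subrr.
  exists (fun k => (xs k, deltas k)), (fun k => lams k *m jacobian_mx F (xs k)).
  split; first exact: cvg_pair xs_xbar deltas0.
    exact: cvg_residual_sub_gradient cf xs_xbar epss0 epssE.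
  by move=> k; exists (lams k); first exact: lamsN.
- move=> [xs [lams [epss [xs_xbar epss0 epssE lamsN]]]] reg.
  have [|lam lamN lamE] := reg (- gradient f xbar); last first.
    by exists lam; split=> //; rewrite lamE subrr.
  exists xs, (fun k => lams k *m jacobian_mx F (xs k)).
  split=> [//||].
    exact: cvg_residual_sub_gradient cf xs_xbar epss0 epssE.
  by move=> k; exists (lams k); first exact: lamsN.
Qed.
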